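(* Let $U,V$ be Banach spaces, let $F:D(F)\subset U\to V$ be a nonlinear operator, let $1\le p<\infty$, $v\in V$, $u_0\in U$, and put $R(u)=\|u-u_0\|^p$ for $u\in U$. Assume: (1) $u^{\dagger}$ is an $R$-minimizing solution of $F(u)=v$. (2) Assumption 1 (stated in the context) holds with $R(u)=\|u-u_0\|^p$. (3) There is a constant $K_1>0$ such that $\|u_0-u^{\dagger}\|\le K_1$. (4) There are constants $M>0$, $C>0$, an index function $\eth$, and a norm $\|\cdot\|_{\eta}$ on $U$ inducing a topology coarser than the norm topology of $U$, such that $$\|u_1-u_2\|_{\eta}\le C\,\eth\big(\|F(u_1)-F(u_2)\|\big)$$ for all $u_1,u_2\in D(F)$ with $\|u_1-u_2\|\le M$. Further, let $\alpha=\alpha(\delta)$ be such that $0<\alpha(\delta)\le\alpha_{\max}$ and $\frac{\delta^p}{\alpha(\delta)}\le c$ for a constant $c>0$, and suppose that $M$ and $K_1$ satisfy $$(c+K_1^p)^{1/p}+K_1\le M,\qquad K_1^p\le\frac{K_2}{\alpha_{\max}}$$ for some $K_2>0$. For $v^{\delta}\in V$ with $\|v^{\delta}-v\|\le\delta$, let $u_{\alpha}^{\delta}$ be a minimizer over $u\in D(F)$ of the Tikhonov functional $$T_{\alpha}(u,\delta)=\|F(u)-v^{\delta}\|^p+\alpha\|u-u_0\|^p,\qquad \alpha=\alpha(\delta).$$ Then, for $\alpha(\delta)\sim\delta^{p-\epsilon}$ with $0<\epsilon<p$, $$\|u_{\alpha}^{\delta}-u^{\dagger}\|_{\eta}=O\Big(\eth\big(\delta^{\frac{p-\epsilon}{p}}\big)\Big)\qquad\text{for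 }\delta\to0.$$
   Context: The symbol $\|\cdot\|$ denotes the norm of $U$ and of $V$. An index function is a function $\eth:[0,\infty)\to[0,\infty)$ that is continuous and strictly monotonically increasing with $\eth(0)=0$. For a functional $R:U\to[0,\infty]$, let $D(R)=\{u\in U:R(u)<\infty\}$ and $D=D(F)\cap D(R)$. An element $u^{\dagger}\in D$ is an $R$-minimizing solution of $F(u)=v$ if $F(u^{\dagger})=v$ and $R(u^{\dagger})=\min\{R(u):u\in D,\ F(u)=v\}$. For $\alpha>0$, write $T_{\alpha}(u,\delta)=\|F(u)-v^{\delta}\|^p+\alpha R(u)$ for $u\in D(F)$, where $v^\delta\in V$ denotes noisy data with $\|v^{\delta}-v\|\le\delta$. In particular, $T_{\alpha}(u,0)=\|F(u)-v\|^p+\alpha R(u)$. Assumption 1 consists of the following conditions: (1) The Banach spaces $U$ and $V$ are associated with topologies $O_U$ and $O_V$, respectively, which are coarser than the norm topologies. (2) The norm of $V$ is sequentially lower semi-continuous with respect to $O_V$. (3) The functional $R:U\to[0,\infty]$ is convex and sequentially lower semi-continuous with respect to $O_U$. (4) $D=D(F)\cap D(R)\neq\emptyset$. (5) For every $\alpha>0$ and $K>0$, the level set $M_{\alpha}(K)=\{u\in D:T_{\alpha}(u,0)\le K\}$ is sequentially pre-compact and closed with respect to $O_U$. (6) For every $\alpha>0$ and $K>0$, the restriction of $F$ to $M_{\alpha}(K)$ is sequentially continuous with respect to $O_U$ and $O_V$. The notation $\alpha(\delta)\sim\delta^{p-\epsilon}$ means that there are constants $0<c_1\le c_2$ with $c_1\delta^{p-\epsilon}\le\alpha(\delta)\le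 c_2\delta^{p-\epsilon}$ for all sufficiently small $\delta>0$. *)

(* Defs.v *)
From HB Require Import structures.
From mathcomp Require Import all_boot all_order all_algebra.
From mathcomp Require Import all_classical all_reals all_analysis.
Import Order.TTheory GRing.Theory Num.Theory.
Import numFieldNormedType.Exports.

Set Implicit Arguments.
Unset Strict Implicit.
Unset Printing Implicit Defensive.

Local Open Scope classical_set_scope.
Local Open Scope ring_scope.

(* An additional topology on a type that already carries a canonical one (here
   the norm topology).  No compatibility with the vector space structure and no
   separation property is assumed.  [top_space O] is [T] seen as a
   topologicalType through [O]; it is convertible to [T]. *)
Definition topology_on (T : Type) : Type := Topological.axioms_ T.
Definition top_space (T : Type) (O : topology_on T) : topologicalType :=
  Topological.Pack O.
Definition opens (T : Type) (O : topology_on T) : set (set T) :=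
  @open (top_space O).

Definition coarser (T : topologicalType) (O : set (set T)) : Prop :=
  O `<=` @open T.

Definition cvg_in (T : Type) (O : topology_on T) (u : nat -> T) (x : T) : Prop :=
  u @ \oo --> (x : top_space O).

Section SequentialNotions.
Context {R : realType} {S T : Type}.
Variables (OS : topology_on S) (OT : topology_on T).

Definition seq_lsc (f : T -> \bar R) : Prop :=
  forall (u : nat -> T) (x : T),
    cvg_in OT u x -> (f x <= limn_einf (fun n => f (u n)))%E.

(* The limit of the subsequence is not required to lie in [A]. *)
Definition seq_precompact (A : set T) : Prop :=
  forall u : nat -> T, (forall n, A (u n)) ->
    exists (k : nat -> nat) (x : T),
      {homo k : m n / (m < n)%N} /\ cvg_in OT (u \o k) x.

Definition seq_closed (A : set T) : Prop :=
  forall (u : nat -> T) (x : T),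
    (forall n, A (u n)) -> cvg_in OT u x -> A x.

Definition seq_continuous_on (A : set S) (f : S -> T) : Prop :=
  forall (u : nat -> S) (x : S),
    (forall n, A (u n)) -> A x -> cvg_in OS u x -> cvg_in OT (f \o u) (f x).

End SequentialNotions.

Definition convex_functional (R : realType) (U : lmodType R) (f : U -> \bar R) :
    Prop :=
  forall (x y : U) (t : R), 0 <= t <= 1 ->
    (f (t *: x + (1 - t) *: y)%R <= t%:E * f x + (1 - t)%R%:E * f y)%E.

Record is_norm (R : realType) (U : lmodType R) (N : U -> R) : Prop := IsNorm {
  norm_triangle : forall x y, N (x + y) <= N x + N y ;
  norm_scale : forall (a : R) x, N (a *: x) = `|a| * N x ;
  norm_definite : forall x, N x = 0 -> x = 0
}.

Definition norm_opens (R : realType) (U : lmodType R) (N : U -> R) :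
    set (set U) :=
  [set A | forall x, A x ->
     exists2 e : R, 0 < e & [set y | N (y - x) < e] `<=` A].

(* Only the values on [0, +oo[ are meaningful. *)
Record index_function (R : realType) (f : R -> R) : Prop := IndexFunction {
  index_ge0 : forall t, 0 <= t -> 0 <= f t ;
  index_continuous : {within `[0, +oo[, continuous f} ;
  index_increasing : forall s t, 0 <= s -> s < t -> f s < f t ;
  index_0 : f 0 = 0
}.

(* The operator F : D(F) -> V is a total function [F] together with the set
   [DF]; the values of [F] outside [DF] are never used. *)
Section Tikhonov.
Context {R : realType} {U V : completeNormedModType R}.
Variables (DF : set U) (F : U -> V) (Rf : U -> \bar R) (p : R).

Definition domR : set U := [set u | (Rf u < +oo)%E].

Definition Rmin_solution (v : V) (u : U) : Prop :=
  [/\ (DF `&` domR) u, F u = v &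
      forall w, (DF `&` domR) w -> F w = v -> (Rf u <= Rf w)%E].

Definition tikhonov (a : R) (y : V) (u : U) : \bar R :=
  ((`|F u - y| `^ p)%R%:E + a%:E * Rf u)%E.

Definition tikhonov_minimizer (a : R) (y : V) (u : U) : Prop :=
  DF u /\ forall w, DF w -> (tikhonov a y u <= tikhonov a y w)%E.

Definition level_set (v : V) (a K : R) : set U :=
  [set u | (DF `&` domR) u /\ (tikhonov a v u <= K%:E)%E].

Record standing_assumption (OU : topology_on U) (OV : topology_on V) (v : V) :
    Prop := StandingAssumption {
  sa_coarserU : coarser (opens OU) ;
  sa_coarserV : coarser (opens OV) ;
  sa_norm_lsc : seq_lsc OV (fun y : V => (`|y|%:E : \bar R)) ;
  sa_Rf_ge0 : forall u, (0 <= Rf u)%E ;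
  sa_Rf_convex : convex_functional Rf ;
  sa_Rf_lsc : seq_lsc OU Rf ;
  sa_dom : DF `&` domR !=set0 ;
  sa_precompact : forall a K, 0 < a -> 0 < K ->
    seq_precompact OU (level_set v a K) ;
  sa_closed : forall a K, 0 < a -> 0 < K -> seq_closed OU (level_set v a K) ;
  sa_continuous : forall a K, 0 < a -> 0 < K ->
    seq_continuous_on OU OV (level_set v a K) F
}.

End Tikhonov.

Definition norm_penalty (R : realType) (U : normedModType R) (u0 : U) (p : R) :
    U -> \bar R :=
  fun u => (`|u - u0| `^ p)%:E.

(* f(d) ~ g(d) as d decreases to 0. *)
Definition same_order_at0 (R : realType) (f g : R -> R) : Prop :=
  exists c1 c2 : R, [/\ 0 < c1, c1 <= c2 &
    \forall d \near 0^'+, c1 * g d <= f d <= c2 * g d].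

(* Main.v *)
Require Import Defs.
From HB Require Import structures.
From mathcomp Require Import all_boot all_order all_algebra.
From mathcomp Require Import all_classical all_reals all_analysis.
From mathcomp Require Import ring lra.
Import Order.TTheory GRing.Theory Num.Theory.
Import numFieldNormedType.Exports.
Local Open Scope classical_set_scope.
Local Open Scope ring_scope.

(** The minimality of a Tikhonov minimizer [u], tested against [udag], bounds
the residual by
  [|F u - vd|^p <= d^p + alpha d * (R udag - R u)].
Estimating the last factor by [R udag] gives only
[|F u - v| <= B * d^((p - eps)/p)] with some constant [B], which does not
suffice: an index function need not satisfy [eth (B * t) = O(eth t)]
(consider [exp (- 1/t)]), so no constant larger than 1 can be pulled out of
[eth].

The constant is improved to an arbitrarily small one because
[R udag - R u] is asymptotically nonpositive.  The residual tends to [0], and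
the compactness and closedness of the level sets of [T_a(., 0)] make the least
penalty attainable with residual at most [r] lower semicontinuous at [r = 0],
where its value is [R udag] ([penalty_lsc_of_residual]).  As
[d^p = o(d^(p - eps))] and [alpha d = O(d^(p - eps))], the residual is therefore
[o(d^((p - eps)/p))] ([residual_littleo]), in particular at most
[d^((p - eps)/p)] for small [d].

The same minimality estimate, with [d^p / alpha d <= c], keeps the minimizers
within distance [M] of [udag]; the stability estimate and the monotonicity of
[eth] then give the rate with the constant [C] itself. *)

Lemma powR_le_cancel (R : realType) (p x y : R) :
  0 < p -> 0 <= x -> 0 <= y -> x `^ p <= y `^ p -> x <= y.
Proof.
move=> p0 x0 y0; apply: contraTT; rewrite -!ltNge => yx.
by apply: gt0_ltr_powR; rewrite ?nnegrE.
Qed.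

Lemma powR_le_root (R : realType) (p x y : R) :
  0 < p -> 0 <= x -> 0 <= y -> x `^ p <= y -> x <= y `^ p^-1.
Proof.
move=> p0 x0 y0 xy; apply: (powR_le_cancel _ p) => //; first exact: powR_ge0.
by rewrite -powRrM mulVf ?gt_eqF// powRr1.
Qed.

Lemma powR_near0_le (R : realType) (a e : R) :
  0 < a -> 0 < e -> \forall d \near 0^'+, d `^ a <= e.
Proof.
move=> a0 e0; have /cvgrPdist_le /(_ _ e0) := powR_cvg0 a0.
apply: filterS => d; rewrite sub0r normrN.
exact/le_trans/ler_norm.
Qed.

Lemma cvg_in_shift (T : Type) (O : topology_on T) (u : nat -> T) (x : T) (N : nat) :
  cvg_in O u x -> cvg_in O (fun n => u (n + N)%N) x.
Proof. by apply: cvg_comp; exact: cvg_addnr. Qed.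

Section FinitePenalty.
Context {R : realType} {U V : completeNormedModType R}.
Variables (DF : set U) (F : U -> V) (J : U -> R) (p : R).
Hypothesis p_ge1 : 1 <= p.
Hypothesis J_ge0 : forall u, 0 <= J u.

Let Rf (u : U) : \bar R := (J u)%:E.

Let p_gt0 : 0 < p. Proof. exact: lt_le_trans p_ge1. Qed.

Lemma level_set_finite (v : V) (a K : R) (u : U) :
  level_set DF F Rf p v a K u <-> DF u /\ `|F u - v| `^ p + a * J u <= K.
Proof.
rewrite /level_set /tikhonov /= /domR /= -EFinM -EFinD lee_fin.
by split=> [[[? _] ?]|[? ?]]; split=> //; split=> //; exact: ltry.
Qed.

(** The exact solution [w] is a competitor whose residual is at most the noise
level. *)
Lemma minimizer_le (a d : R) (v vd : V) (w u : U) :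
  DF w -> F w = v -> `|vd - v| <= d ->
  tikhonov_minimizer DF F Rf p a vd u ->
  `|F u - vd| `^ p + a * J u <= d `^ p + a * J w.
Proof.
move=> Dw Fw vdd [_ /(_ w Dw)].
rewrite /tikhonov -!EFinM -!EFinD lee_fin => /le_trans; apply.
rewrite lerD2r Fw distrC; apply: ge0_ler_powR => //; first exact: ltW.
- by rewrite nnegrE.
- by rewrite nnegrE (le_trans _ vdd).
Qed.

(** Otherwise there are points [u n] with residuals tending to [0] and penalties
below [J w - s].  They stay in a level set, so a subsequence converges to some
[x].  For every [a > 0] a tail of this subsequence lies in the level set of
[T_a(., 0)] at height [a * (J w - s / 2)], hence so does [x].  Letting [a] tend
to [0] forces [F x = v], while [a = 1] gives [J x < J w]. *)
Lemma penalty_lsc_of_residual (OU : topology_on U) (v : V) (w : U) :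
  (forall a K, 0 < a -> 0 < K -> seq_precompact OU (level_set DF F Rf p v a K)) ->
  (forall a K, 0 < a -> 0 < K -> seq_closed OU (level_set DF F Rf p v a K)) ->
  (forall x, DF x -> F x = v -> J w <= J x) ->
  forall s, 0 < s -> exists2 r, 0 < r &
    forall u, DF u -> `|F u - v| <= r -> J w - s <= J u.
Proof.
move=> precomp clos wmin s s0; apply: contrapT => noR.
have /choice[u uP] (n : nat) : exists u,
    [/\ DF u, `|F u - v| <= n.+1%:R^-1 & J u < J w - s].
  apply: contrapT => nou; apply: noR; exists n.+1%:R^-1 => // x Dx xv.
  by rewrite leNgt; apply/negP => Jx; apply: nou; exists x.
have resid n : `|F (u n) - v| `^ p <= n.+1%:R^-1.
  have [_ un _] := uP n.
  apply: (@le_trans _ _ (n.+1%:R^-1 `^ p)).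
    by apply: ge0_ler_powR; rewrite ?nnegrE// ltW.
  by apply: ge1r_powR => //; rewrite invr_gt0 ltr0n invf_le1 ?ltr0n// ler1n.
have K_gt0 : 0 < J w - s / 2.
  by have [_ _ +] := uP 0%N; have := J_ge0 (u 0%N); lra.
have K1_gt0 : 0 < 1 + J w by have := J_ge0 w; lra.
have [|k [x [kS kx]]] := precomp 1 (1 + J w) ltr01 K1_gt0 u.
  move=> n; apply/level_set_finite; have [Dn _ Jn] := uP n; split=> //.
  have : `|F (u n) - v| `^ p <= 1.
    by rewrite (le_trans (resid n))// invf_le1 ?ltr0n// ler1n.
  by lra.
(* The tail starts where the residual term is at most [a * s / 2], half of the
   gain [a * s] that the penalty offers. *)
have xlevel a : 0 < a ->
    DF x /\ `|F x - v| `^ p + a * J x <= a * (J w - s / 2).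
  move=> a0; apply/level_set_finite.
  have as0 : 0 < a * s / 2 by rewrite divr_gt0// mulr_gt0.
  have [N _ NP] := near_infty_natSinv_lt (PosNum as0).
  apply: (clos _ _ a0 (mulr_gt0 a0 K_gt0) _ _ _ (cvg_in_shift _ _ _ _ N kx)) => n.
  apply/level_set_finite; rewrite /comp.
  set m := k (n + N)%N; have [Dm _ Jm] := uP m; split=> //.
  have Nm : (N <= m)%N.
    exact: leq_trans (leq_addl _ _) (unstable.mono_leq_infl (leq_mono kS) _).
  have : `|F (u m) - v| `^ p <= a * s / 2.
    by rewrite (le_trans (resid m))// ltW//; exact: NP.
  have : a * J (u m) <= a * (J w - s) by rewrite ler_pM2l// ltW.
  by lra.
have [Dx x1] := xlevel 1 ltr01.
have Fx : F x = v.
  apply/subr0_eq/normr0_eq0/(@powR_eq0_eq0 _ _ p).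
  apply/eqP; rewrite eq_le powR_ge0 andbT.
  apply/ler_addgt0Pr => e e0; rewrite add0r.
  have a0 : 0 < e / (J w - s / 2) by rewrite divr_gt0.
  have [_] := xlevel _ a0; rewrite divfK ?gt_eqF//.
  by have := mulr_ge0 (ltW a0) (J_ge0 x); lra.
have := wmin x Dx Fx; have := powR_ge0 (`|F x - v|) p; lra.
Qed.

(** With [t = d^((p - eps)/p)] the two scales are [d^p = t^p * d^eps] and
[alpha d <= b * t^p].  A crude bound makes the residual small enough for
[penalty_lsc_of_residual] to apply; its conclusion makes the penalty gap small
and yields the sharp bound. *)
Lemma residual_littleo (OU : topology_on U) (v : V) (w : U)
    (alpha : R -> R) (b eps : R) :
  (forall a K, 0 < a -> 0 < K -> seq_precompact OU (level_set DF F Rf p v a K)) ->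
  (forall a K, 0 < a -> 0 < K -> seq_closed OU (level_set DF F Rf p v a K)) ->
  DF w -> F w = v -> (forall x, DF x -> F x = v -> J w <= J x) ->
  0 < b -> 0 < eps < p ->
  (\forall d \near 0^'+, 0 < alpha d <= b * d `^ (p - eps)) ->
  forall theta, 0 < theta -> \forall d \near 0^'+, forall vd u,
    `|vd - v| <= d -> tikhonov_minimizer DF F Rf p (alpha d) vd u ->
    `|F u - v| <= theta * d `^ ((p - eps) / p).
Proof.
move=> precomp clos Dw Fw wmin b0 /andP[eps0 epsp] alphab theta theta0.
(* Half of [theta] is left for the noise [|vd - v| <= d = o(t)].  The other half,
   raised to the power [p], is shared equally by [d^p] and by the penalty gap,
   which is why the gap is requested to be at most [h / 2 / b]. *)
set h := (theta / 2) `^ p.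
have h0 : 0 < h by rewrite powR_gt0// divr_gt0.
have s0 : 0 < h / 2 / b by rewrite !divr_gt0.
have [r r0 rP] := penalty_lsc_of_residual _ _ _ precomp clos wmin _ s0.
have q0 : 0 < p - eps by rewrite subr_gt0.
have B0 : 0 < 1 + b * J w by have := mulr_ge0 (ltW b0) (J_ge0 w); lra.
near=> d => vd u vdd umin.
have d0 : 0 < d by near: d; exact: nbhs_right_gt.
have /andP[a0 ab] : 0 < alpha d <= b * d `^ (p - eps) by near: d.
have := minimizer_le _ _ _ _ _ _ Dw Fw vdd umin; have [Du _] := umin.
set res := `|F u - vd|; set t := d `^ ((p - eps) / p) => minle.
have tp : t `^ p = d `^ (p - eps) by rewrite -powRrM divfK// gt_eqF.
have t0 : 0 <= t by exact: powR_ge0.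
have dp : d `^ p = t `^ p * d `^ eps.
  by rewrite tp -powRD ?subrK// (gt_eqF d0) implybT.
have dt : d = t * d `^ (eps / p).
  rewrite -powRD ?(gt_eqF d0) ?implybT// -mulrDl subrK divff ?gt_eqF//.
  by rewrite powRr1// ltW.
have tri : `|F u - v| <= res + d.
  by rewrite (le_trans (ler_distD vd _ _))// lerD2l.
have tp0 : 0 <= t `^ p by exact: powR_ge0.
have resr : res <= r / 2.
  apply: (powR_le_cancel _ p) => //; first exact: normr_ge0.
    by rewrite divr_ge0// ltW.
  apply: (@le_trans _ _ (t `^ p * (1 + b * J w))).
    have : t `^ p * d `^ eps <= t `^ p * 1.
      by rewrite ler_wpM2l//; near: d; exact: powR_near0_le.
    have := ler_wpM2r (J_ge0 w) ab; have := mulr_ge0 (ltW a0) (J_ge0 u).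
    by rewrite -tp in minle *; rewrite dp in minle; lra.
  rewrite -ler_pdivlMr// tp; near: d; apply: powR_near0_le => //.
  by rewrite divr_gt0// powR_gt0// divr_gt0.
have Jlow : J w - h / 2 / b <= J u.
  apply: rP => //; apply: (le_trans tri).
  have : d <= r / 2 by near: d; apply: nbhs_right_le; rewrite divr_gt0.
  by lra.
have rest : res <= theta / 2 * t.
  apply: (powR_le_cancel _ p) => //; first exact: normr_ge0.
    by rewrite mulr_ge0// ltW// divr_gt0.
  rewrite powRM ?divr_ge0 ?(ltW theta0)// -/h.
  have small : t `^ p * d `^ eps <= t `^ p * (h / 2).
    by rewrite ler_wpM2l//; near: d; apply: powR_near0_le => //; rewrite divr_gt0.
  have gap : alpha d * (J w - J u) <= alpha d * (h / 2 / b).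
    by rewrite ler_pM2l//; lra.
  have : alpha d * (h / 2 / b) <= b * t `^ p * (h / 2 / b).
    by rewrite ler_pM2r// tp.
  have -> : b * t `^ p * (h / 2 / b) = t `^ p * (h / 2).
    by field; rewrite gt_eqF.
  by rewrite dp in minle; lra.
have : t * d `^ (eps / p) <= t * (theta / 2).
  rewrite ler_wpM2l//; near: d; apply: powR_near0_le; first exact: divr_gt0.
  by rewrite divr_gt0.
by rewrite -dt; lra.
Unshelve. all: by end_near.
Qed.

End FinitePenalty.

Theorem theorem1 (R : realType) (U V : completeNormedModType R)
    (OU : topology_on U) (OV : topology_on V)
    (DF : set U) (F : U -> V) (p : R) (v : V) (u0 udag : U)
    (K1 M C : R) (eth : R -> R) (eta : U -> R)
    (alpha : R -> R) (alpha_max c K2 eps : R)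
    (hp : 1 <= p)
    (hudag : Rmin_solution DF F (norm_penalty u0 p) v udag)
    (hass : standing_assumption DF F (norm_penalty u0 p) p OU OV v)
    (hK1 : 0 < K1) (hudagK1 : `|u0 - udag| <= K1)
    (hM : 0 < M) (hC : 0 < C) (heth : index_function eth)
    (heta : is_norm eta) (hetacoarser : coarser (norm_opens eta))
    (hstab : forall u1 u2 : U, DF u1 -> DF u2 -> `|u1 - u2| <= M ->
       eta (u1 - u2) <= C * eth `|F u1 - F u2|)
    (hc : 0 < c) (hK2 : 0 < K2)
    (halpha : \forall d \near 0^'+, 0 < alpha d <= alpha_max)
    (halphac : \forall d \near 0^'+, d `^ p / alpha d <= c)
    (hMK1 : (c + K1 `^ p) `^ p^-1 + K1 <= M)
    (hK1K2 : K1 `^ p <= K2 / alpha_max)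
    (heps : 0 < eps < p)
    (hrate : same_order_at0 alpha (fun d => d `^ (p - eps))) :
  exists2 A : R, 0 < A &
    \forall d \near 0^'+, forall (vd : V) (ud : U),
      `|vd - v| <= d ->
      tikhonov_minimizer DF F (norm_penalty u0 p) p (alpha d) vd ud ->
      eta (ud - udag) <= A * eth (d `^ ((p - eps) / p)).
Proof.
pose J u := `|u - u0| `^ p.
have J_ge0 u : 0 <= J u by exact: powR_ge0.
have p_gt0 : 0 < p by exact: lt_le_trans hp.
have [[Dw _] Fw wmin] := hudag.
have wminJ x : DF x -> F x = v -> J udag <= J x.
  by move=> Dx Fx; rewrite -lee_fin; apply: wmin => //; split=> //; exact: ltry.
have [c1 [c2 [c1_gt0 c12 rate]]] := hrate.
have alpha_le : \forall d \near 0^'+, 0 < alpha d <= c2 * d `^ (p - eps).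
  by apply: filterS2 halpha rate => d /andP[-> _] /andP[_ ->].
have residual := residual_littleo DF F J p hp J_ge0 OU v udag alpha c2 eps
  (sa_precompact hass) (sa_closed hass) Dw Fw wminJ
  (lt_le_trans c1_gt0 c12) heps alpha_le 1 ltr01.
have JK1 : J udag <= K1 `^ p.
  by apply: ge0_ler_powR; rewrite ?nnegrE 1?distrC// ltW.
exists C => //; near=> d => vd ud vdd udmin.
have [Du _] := udmin.
have /andP[a_gt0 _] : 0 < alpha d <= alpha_max by near: d.
have res : `|F ud - F udag| <= d `^ ((p - eps) / p).
  rewrite Fw -[leRHS]mul1r; move: vd ud vdd udmin {Du}; near: d.
  exact: residual.
(* The distance passes through [u0]: [udag] is at distance at most [K1] from it,
   and the bound on the penalty of [ud] controls the rest. *)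
have close : `|ud - udag| <= M.
  have rad : `|ud - u0| <= (c + K1 `^ p) `^ p^-1.
    apply: powR_le_root => //; first by rewrite addr_ge0 ?powR_ge0// ltW.
    rewrite -(ler_pM2l a_gt0) mulrDr.
    have : d `^ p <= alpha d * c.
      by rewrite mulrC -ler_pdivrMr//; near: d.
    have := minimizer_le DF F J p hp (alpha d) d v vd udag ud Dw Fw vdd udmin.
    have := powR_ge0 (`|F ud - vd|) p.
    have : alpha d * J udag <= alpha d * K1 `^ p by rewrite ler_pM2l.
    by rewrite /J; lra.
  by rewrite (le_trans (ler_distD u0 _ _))// (le_trans _ hMK1)// lerD.
apply: (le_trans (hstab _ _ Du Dw close)); rewrite ler_pM2l//.
(* Monotonicity of [eth] is only given for strict inequalities. *)
have [->//|ne] := eqVneq (`|F ud - F udag|) (d `^ ((p - eps) / p)).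
by rewrite ltW// (index_increasing heth)// lt_neqAle ne.
Unshelve. all: by end_near.
Qed.
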